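(* Define integers $c(n)$, $n\ge 0$, by the power series expansion $$\prod_{m=1}^{\infty}\frac{1-q^m}{(1-q^{2m})^2(1-q^{3m})^3}=\sum_{n\ge 0}c(n)q^n .$$ Then for every integer $n\ge 0$, $$\operatorname{sgn}(c(n))=\begin{cases}1&\text{if } n\equiv 0,2,3\pmod 6,\\ -1&\text{if } n\equiv 1,5\pmod 6,\\ 0&\text{if } n\equiv 4\pmod 6.\end{cases}$$
   Context: Here $\operatorname{sgn}(x)$ is $1$, $0$ or $-1$ according to whether the real number $x$ is positive, zero or negative. (Equivalently, $\sum_{n\ge0}c(n)q^n=q^{1/2}\,\eta(\tau)/(\eta(2\tau)^2\eta(3\tau)^3)$ with $q=e^{2\pi i\tau}$ and $\eta(\tau)=q^{1/24}\prod_{m\ge1}(1-q^m)$ the Dedekind eta function.) *)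

(* Defs.v *)
From HB Require Import structures.
From mathcomp Require Import all_boot all_order all_algebra.
From mathcomp Require Import boolp.

Set Implicit Arguments.
Unset Strict Implicit.
Unset Printing Implicit Defensive.
Import GRing.Theory.
Local Open Scope ring_scope.

(* The ring R[[q]] of formal power series, with the Cauchy product. *)
Record fps (R : Type) := Fps { fcoef : nat -> R }.

HB.instance Definition _ (R : Type) := gen_eqMixin (fps R).
HB.instance Definition _ (R : Type) := gen_choiceMixin (fps R).

Section FpsRing.
Variable R : comNzRingType.
Implicit Types f g h : fps R.

Lemma fpsP f g : (forall n, fcoef f n = fcoef g n) -> f = g.
Proof. by case: f g => [f] [g] /= /funext ->. Qed.

Definition fps_zero : fps R := Fps (fun=> 0).
Definition fps_one : fps R := Fps (fun n => (n == 0%N)%:R).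
Definition fps_opp f : fps R := Fps (fun n => - fcoef f n).
Definition fps_add f g : fps R := Fps (fun n => fcoef f n + fcoef g n).
Definition fps_mul f g : fps R :=
  Fps (fun n => \sum_(i < n.+1) fcoef f i * fcoef g (n - i)%N).

Fact fps_addA : associative fps_add.
Proof. by move=> f g h; apply: fpsP => n /=; rewrite addrA. Qed.
Fact fps_addC : commutative fps_add.
Proof. by move=> f g; apply: fpsP => n /=; rewrite addrC. Qed.
Fact fps_add0 : left_id fps_zero fps_add.
Proof. by move=> f; apply: fpsP => n /=; rewrite add0r. Qed.
Fact fps_addN : left_inverse fps_zero fps_opp fps_add.
Proof. by move=> f; apply: fpsP => n /=; rewrite addNr. Qed.

HB.instance Definition _ :=
  GRing.isZmodule.Build (fps R) fps_addA fps_addC fps_add0 fps_addN.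

Definition fps_trunc N f : {poly R} := \poly_(i < N) fcoef f i.

Lemma coef_fps_trunc N f i : (i < N)%N -> (fps_trunc N f)`_i = fcoef f i.
Proof. by move=> iN; rewrite coef_poly iN. Qed.

Lemma fps_mul_trunc N f g i : (i < N)%N ->
  fcoef (fps_mul f g) i = (fps_trunc N f * fps_trunc N g)`_i.
Proof.
move=> iN; rewrite coefM; apply: eq_bigr => j _.
rewrite !coef_fps_trunc //; first exact: leq_ltn_trans (leq_subr _ _) iN.
by apply: leq_ltn_trans iN; rewrite -ltnS.
Qed.

Fact fps_mulC : commutative fps_mul.
Proof.
move=> f g; apply: fpsP => n.
by rewrite !(fps_mul_trunc _ _ (ltnSn n)) mulrC.
Qed.

Lemma fps_mul_mul_trunc f g h n :
  fcoef (fps_mul (fps_mul f g) h) n =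
  (fps_trunc n.+1 f * fps_trunc n.+1 g * fps_trunc n.+1 h)`_n.
Proof.
rewrite coefM; apply: eq_bigr => j _.
by rewrite (@fps_mul_trunc n.+1) // coef_fps_trunc // ltnS leq_subr.
Qed.

Fact fps_mulA : associative fps_mul.
Proof.
move=> f g h; apply: fpsP => n.
rewrite fps_mulC !fps_mul_mul_trunc; congr (_`_n).
by rewrite mulrC mulrA.
Qed.

Fact fps_mul1 : left_id fps_one fps_mul.
Proof.
move=> f; apply: fpsP => n /=.
rewrite big_ord_recl /= mul1r subn0 big1 ?addr0 // => i _.
by rewrite mul0r.
Qed.

Fact fps_mulDl : left_distributive fps_mul fps_add.
Proof.
move=> f g h; apply: fpsP => n /=; rewrite -big_split.
by apply: eq_bigr => i _; rewrite mulrDl.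
Qed.

Fact fps_one_neq0 : fps_one != 0.
Proof.
apply/eqP => /(congr1 (fun f => fcoef f 0)) /= /eqP.
by rewrite oner_eq0.
Qed.

HB.instance Definition _ := GRing.Zmodule_isComNzRing.Build (fps R)
  fps_mulA fps_mulC fps_mul1 fps_mulDl fps_one_neq0.

(* The inverse is the true one whenever it exists, and the identity otherwise,
   as ssralg prescribes. *)
Definition fps_unit : {pred fps R} := fun f => `[< exists g, g * f = 1 >].
Definition fps_inv f : fps R :=
  if pselect (exists g, g * f = 1) is left ex then projT1 (cid ex) else f.

Fact fps_mulV : {in fps_unit, left_inverse 1 fps_inv *%R}.
Proof.
move=> f /asboolP uf; rewrite /fps_inv; case: pselect => // ex.
by case: (cid ex).
Qed.
Fact fps_unitP f g : g * f = 1 -> fps_unit f.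
Proof. by move=> gf; apply/asboolP; exists g. Qed.
Fact fps_inv_out : {in [predC fps_unit], fps_inv =1 id}.
Proof.
move=> f; rewrite inE => /asboolPn nuf.
by rewrite /fps_inv; case: pselect.
Qed.

HB.instance Definition _ := GRing.ComNzRing_hasMulInverse.Build (fps R)
  fps_mulV fps_unitP fps_inv_out.

Definition fpsX : fps R := Fps (fun n => (n == 1%N)%:R).

(* f = \prod_(m >= 1) F m in R[[q]]: each coefficient of the partial products
   is eventually equal to that of f. *)
Definition fps_is_infprod (F : nat -> fps R) f :=
  forall n, exists N0, forall N, (N0 <= N)%N ->
    fcoef (\prod_(1 <= m < N.+1) F m) n = fcoef f n.

Lemma fcoef0 n : fcoef (0 : fps R) n = 0. Proof. by []. Qed.
Lemma fcoef1 n : fcoef (1 : fps R) n = (n == 0%N)%:R. Proof. by []. Qed.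
Lemma fcoefB f g n : fcoef (f - g) n = fcoef f n - fcoef g n.
Proof. by []. Qed.
Lemma fcoefM f g n :
  fcoef (f * g) n = \sum_(i < n.+1) fcoef f i * fcoef g (n - i)%N.
Proof. by []. Qed.

Lemma fcoefXn k n : fcoef (fpsX ^+ k) n = (n == k)%:R.
Proof.
elim: k n => [|k IH] n; first by rewrite expr0.
rewrite exprS fcoefM; case: n => [|n].
  by rewrite big_ord_recl big_ord0 /= mul0r addr0.
rewrite big_ord_recl /= mul0r add0r big_ord_recl /= mul1r IH big1 ?addr0.
  by rewrite subSS subn0 eqSS.
by move=> i _; rewrite mul0r.
Qed.

(* f = 1 + O(q^m) *)
Definition fps_near1 m f :=
  forall i, (i < m)%N -> fcoef f i = (i == 0%N)%:R.

Lemma fps_near1_coefM m f g i : fps_near1 m g -> (i < m)%N ->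
  fcoef (f * g) i = fcoef f i.
Proof.
move=> g1 im; rewrite mulrC fcoefM big_ord_recl g1 ?(leq_ltn_trans _ im) //=.
rewrite mul1r subn0 big1 ?addr0 // => j _.
by rewrite g1 ?mul0r // (leq_ltn_trans _ im).
Qed.

Lemma fps_near1M m f g : fps_near1 m f -> fps_near1 m g -> fps_near1 m (f * g).
Proof. by move=> f1 g1 i im; rewrite (fps_near1_coefM _ g1) // f1. Qed.

Lemma fps_near1X m f k : fps_near1 m f -> fps_near1 m (f ^+ k).
Proof.
move=> f1; elim: k => [|k IH]; first by move=> i _; rewrite expr0.
by rewrite exprS; apply: fps_near1M.
Qed.

Lemma fps_near1V m f : f \is a GRing.unit -> fps_near1 m f -> fps_near1 m f^-1.
Proof.
move=> uf f1 i im; rewrite -(fps_near1_coefM f^-1 f1 im) mulVr //.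
Qed.

Lemma fps_near1_subXn m k : (m <= k)%N -> fps_near1 m (1 - fpsX ^+ k).
Proof.
move=> mk i im; rewrite fcoefB fcoef1 fcoefXn.
by rewrite (ltn_eqF (leq_trans im mk)) subr0.
Qed.

Lemma fps_unit_subXn k : (0 < k)%N -> 1 - fpsX ^+ k \is a GRing.unit.
Proof.
move=> k0; apply/unitrPr; exists (Fps (fun n => (k %| n)%:R)).
rewrite mulrBl mul1r; apply: fpsP => n; rewrite fcoefB fcoef1 fcoefM /=.
have [kn|nk] := leqP k n.
  rewrite (bigD1 (Ordinal (kn : (k < n.+1)%N))) //= fcoefXn eqxx mul1r.
  rewrite big1 ?addr0 => [|j nj]; last first.
    by rewrite fcoefXn -[_ == _]/(j == Ordinal (kn : (k < n.+1)%N)) (negPf nj)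
               mul0r.
  rewrite dvdn_subl // subrr; case: n kn => // /(leq_trans k0).
  by rewrite ltnn.
rewrite big1 ?subr0 => [|j _]; last first.
  by rewrite fcoefXn (ltn_eqF (leq_trans (ltn_ord j) nk)) mul0r.
case: n nk => [|n] nk; first by rewrite dvdn0.
by rewrite gtnNdvd.
Qed.

Lemma fps_infprod_ex (F : nat -> fps R) :
  (forall m, (0 < m)%N -> fps_near1 m (F m)) ->
  exists f, fps_is_infprod F f.
Proof.
move=> F1; exists (Fps (fun n => fcoef (\prod_(1 <= m < n.+2) F m) n)) => n.
exists n.+1 => N /=.
elim: N => // N IH; rewrite leq_eqVlt => /predU1P [<- //|nN].
rewrite big_nat_recr // (@fps_near1_coefM N.+1); first exact: IH.
  exact: F1.
exact: ltnW.
Qed.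

Lemma fps_infprod_uniq (F : nat -> fps R) f g :
  fps_is_infprod F f -> fps_is_infprod F g -> f = g.
Proof.
move=> Ff Fg; apply: fpsP => n.
have [N1 H1] := Ff n; have [N2 H2] := Fg n.
by rewrite -(H1 _ (leq_maxl N1 N2)) (H2 _ (leq_maxr N1 N2)).
Qed.

Lemma eta_quotient_infprod_ex : exists f, fps_is_infprod (fun m =>
  (1 - fpsX ^+ m) /
  ((1 - fpsX ^+ (2 * m)) ^+ 2 * (1 - fpsX ^+ (3 * m)) ^+ 3)) f.
Proof.
apply: fps_infprod_ex => m m0.
apply: fps_near1M; first exact: fps_near1_subXn.
apply: fps_near1V.
  by rewrite unitrM !unitrX // fps_unit_subXn ?muln_gt0.
by apply: fps_near1M; apply: fps_near1X; apply: fps_near1_subXn;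
  rewrite leq_pmull.
Qed.

End FpsRing.

Arguments fpsX {R}.

(* Main.v *)
Require Import Defs.
From HB Require Import structures.
From mathcomp Require Import all_boot all_order all_algebra all_field.
From mathcomp Require Import finmap classical_sets fsbigop.
From mathcomp Require Import zify ring.

(** Write f_k for the product of the 1 - q^(km) over m >= 1, and
    psi(q) = f_2^2 / f_1, which by Jacobi's triple product is the sum of the
    q^(n(n+1)/2) over n >= 0. The generating function of the c(n) is
    1 / (psi(q) f_3^3), and it is split by exponents modulo 6 in two steps.

    Modulo 3: sorting the exponents gives psi(q) = a + q b where a and b are
    series in q^3, namely a = f(q^3, q^6) and b = psi(q^9) for Ramanujan's
    f(a, b). For w a primitive cube root of unity, the product of the psi(w^i q)
    is a^3 + q^3 b^3, and it is also an eta quotient in q^3 as follows from the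
    product form of psi ([psi_cubic]). Hence 1 / psi(q) is
    a^2 - q a b + q^2 b^2 up to an eta quotient in q^3
    ([inv_psi_dissection]). Since a and b are eta quotients themselves, the
    three parts of the generating function are, in Q = q^3, the eta quotients
    f_3^3 / (f_1 f_2^6), - q f_6^3 / f_2^7 and q^2 f_1 f_6^6 / (f_3^3 f_2^8).

    Modulo 2: the middle part is a series in Q^2, which accounts for the zero
    coefficients. The other two involve, besides series in Q^2, only f_3^3 / f_1
    and f_1 / f_3^3; their even and odd parts come from a product of two theta
    series whose double sum is sorted by the parity of m + n
    ([theta15_theta33], [core3_dissection], [core3_inv_dissection]).

    The result is [eta_quotient_dissection]: five components, each a signed
    power of q times an eta quotient in z = q^6. Every such quotient is a
    product of theta functions with nonnegative coefficients, of quotients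
    f_(3k) / f_k, which are products of factors 1 + z^i + z^(2i), and of
    inverses 1 / f_k; a spare factor 1 / (1 - z) makes all coefficients positive
    ([nonneg_positive_in]).

    Each coefficient only depends on the series modulo some power q^N. All the
    identities are therefore proved in an arbitrary commutative ring for an
    element with q^N = 0, where infinite products and theta series are finite,
    the substitutions q -> q^k, -q, w q are again nilpotent elements, and no
    convergence has to be discussed. They are finally applied to q in
    C[q] / (q^N), with C the field of algebraic numbers. *)

Set Implicit Arguments.
Unset Strict Implicit.
Unset Printing Implicit Defensive.
Import Order.TTheory GRing.Theory Num.Theory.
Local Open Scope ring_scope.

(** * Infinite products in a nilpotent variable *)

Section Products.
Variables (A : comNzRingType) (N : nat).
Implicit Types a b q x y : A.

(** Every element that plays the role of the variable, or of a monomial in it,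
    is killed by the same power N; keeping N fixed lets all the truncated
    products below have the same number of factors. *)
Definition nilp a := a ^+ N == 0.

Lemma nilpM a b : nilp a -> nilp (b * a).
Proof. by rewrite /nilp exprMn => /eqP ->; rewrite mulr0. Qed.

Lemma nilpN a : nilp a -> nilp (- a).
Proof. by rewrite /nilp exprNn => /eqP ->; rewrite mulr0. Qed.

Lemma nilpX a k : (0 < k)%N -> nilp a -> nilp (a ^+ k).
Proof. by case: k => // k _ a0; rewrite exprSr; apply: nilpM. Qed.

Lemma nilpX0 a k : nilp a -> (N <= k)%N -> a ^+ k = 0.
Proof. by move=> /eqP a0 Nk; rewrite -(subnKC Nk) exprD a0 mul0r. Qed.

(** The infinite product (a; q)_oo: its factors of index at least N are
    trivial as soon as q^N = 0. *)
Definition poch a q := \prod_(i < N) (1 - a * q ^+ i).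
Definition euler y := poch y y.

Lemma poch_widen a q M : nilp q -> (N <= M)%N ->
  \prod_(i < M) (1 - a * q ^+ i) = poch a q.
Proof.
move=> q0 NM; rewrite -(subnKC NM) big_split_ord /=.
rewrite [X in _ * X]big1 ?mulr1 // => i _.
by rewrite (nilpX0 q0) ?leq_addr // mulr0 subr0.
Qed.

Lemma poch_split k a q : (0 < k)%N -> nilp q ->
  poch a q = \prod_(r < k) poch (a * q ^+ r) (q ^+ k).
Proof.
move=> k0 q0; rewrite -(@poch_widen _ _ (N * k)) //; last first.
  by rewrite leq_pmulr.
rewrite -(big_mkord xpredT (fun i => 1 - a * q ^+ i)) big_nat_mul.
rewrite /poch exchange_big /= big_mkord; apply: eq_bigr => i _.
rewrite -{1}(add0n (i * k)%N) mulSn big_addn addnK big_mkord.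
by apply: eq_bigr => r _; rewrite -mulrA -exprM -exprD mulnC.
Qed.

Lemma poch_mulN a q : poch a q * poch (- a) q = poch (a ^+ 2) (q ^+ 2).
Proof.
rewrite /poch -big_split; apply: eq_bigr => i _ /=.
by rewrite exprAC; ring.
Qed.

Definition geom y := \sum_(i < N) y ^+ i.
Definition invpoch a q := \prod_(i < N) geom (a * q ^+ i).
(** The inverse of an Euler product is taken as an explicit product of
    geometric series, because that form exhibits its coefficients as
    nonnegative. *)
Definition inveuler y := invpoch y y.

Lemma mul_geom y : nilp y -> (1 - y) * geom y = 1.
Proof.
by move=> /eqP y0; rewrite /geom -opprB mulNr -subrX1 y0 sub0r opprK.
Qed.

Lemma euler_inv y : nilp y -> euler y * inveuler y = 1.
Proof.
move=> y0; rewrite /euler /inveuler /poch /invpoch -big_split /= big1 // => i _.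
by apply: mul_geom; rewrite mulrC; apply: nilpM.
Qed.

Lemma euler_cancel y a b : nilp y -> euler y * a = euler y * b -> a = b.
Proof.
move=> y0 /(congr1 (fun c => inveuler y * c)).
by rewrite !mulrA ![inveuler y * _]mulrC euler_inv // !mul1r.
Qed.

End Products.

Section Gauss.
Variables (A : comNzRingType) (q : A).

(** Gaussian binomial coefficients, defined by Pascal's rule and not as a
    quotient since q is not assumed to make 1 - q^i regular. *)
Fixpoint gbin n k : A :=
  match n, k with
  | _, 0 => 1
  | 0, _.+1 => 0
  | n'.+1, k'.+1 => gbin n' k'.+1 + q ^+ (n' - k') * gbin n' k'
  end.

Lemma gbin0 n : gbin n 0 = 1. Proof. by case: n. Qed.

Lemma gbinS n k : gbin n.+1 k.+1 = gbin n k.+1 + q ^+ (n - k) * gbin n k.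
Proof. by []. Qed.

Lemma gbin_small n k : (n < k)%N -> gbin n k = 0.
Proof.
elim: n k => [|n IH] [|k] // nk; rewrite gbinS !IH ?mulr0 ?addr0 //.
exact: ltnW.
Qed.

(** The second Pascal rule is what a new factor on the other side of the
    finite triple product calls for. *)
Lemma gbinS_alt n k : gbin n.+1 k.+1 = q ^+ k.+1 * gbin n k.+1 + gbin n k.
Proof.
elim: n k => [|n IH] [|k].
- by rewrite gbinS /= mulr0 !add0r mulr1.
- by rewrite gbinS /= !mulr0.
- rewrite [LHS]gbinS {1}(IH 0%N) gbinS !gbin0 !subn0 !exprS; ring.
rewrite [LHS]gbinS {1}IH {1}(IH k) [in RHS]gbinS [in RHS]gbinS subSS.
have [nk|kn] := leqP n k; first by rewrite (@gbin_small n k.+1) //; ring.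
have -> : (n - k = (n - k.+1).+1)%N by lia.
by rewrite !exprS; ring.
Qed.

Definition qfact n := \prod_(i < n) (1 - q * q ^+ i).

(** This replaces the quotient formula; it is the source of the limit
    gbin q n k -> 1 / (q; q)_oo when k and n - k both grow. *)
Lemma gbin_qfact n k : (k <= n)%N ->
  gbin n k * qfact k * qfact (n - k) = qfact n.
Proof.
elim: n k => [|n IH] [|k] kn //.
- by rewrite /qfact !big_ord0 !mulr1.
- by rewrite gbin0 subn0 /qfact big_ord0 !mul1r.
rewrite gbinS subSS; move: kn; rewrite ltnS leq_eqVlt => /predU1P[->|kn].
  have := IH n (leqnn n).
  rewrite (@gbin_small n n.+1) // subnn add0r expr0 mul1r.
  by rewrite /qfact !big_ord_recr /= big_ord0 !mulr1 mulrA => ->.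
have := IH _ kn; have := IH _ (ltnW kn).
have -> : (n - k = (n - k.+1).+1)%N by lia.
rewrite /qfact !big_ord_recr /= => E1 E2.
have -> : \prod_(i < n) (1 - q * q ^+ i) * (1 - q * q ^+ n) =
   \prod_(i < n) (1 - q * q ^+ i) * (1 - q ^+ (n - k.+1).+1)
   + q ^+ (n - k.+1).+1 * (\prod_(i < n) (1 - q * q ^+ i) * (1 - q * q ^+ k)).
  have -> : q ^+ n = q ^+ (n - k.+1).+1 * q ^+ k.
    by rewrite -exprD; congr (_ ^+ _); lia.
  ring.
rewrite -{1}E2 -E1 !exprS; ring.
Qed.

End Gauss.

Arguments gbin {A} q n k : simpl never.

(** * Finitely supported sums over the integers *)

Section IntSums.
Variable A : comNzRingType.

(** A concrete set of indices outside of which a series vanishes, used to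
    compute with sums over all integers; such sums are reindexed by
    bijections with no bookkeeping of bounds. *)
Definition window M : {fset int} :=
  seq_fset tt [seq i%:Z - M%:Z | i <- iota 0 (2 * M).+1].

Lemma mem_window M (j : int) : (j \in window M) = (`|j| <= M%:Z).
Proof.
rewrite /window seq_fsetE; apply/mapP/idP => [[i]|jM].
  by rewrite mem_iota => ? ->; lia.
by exists (absz (j + M%:Z)); rewrite ?mem_iota; lia.
Qed.

Lemma sum_window M (f : int -> A) :
  \sum_(j <- window M) f j = \sum_(i < (2 * M).+1) f (i%:Z - M%:Z).
Proof.
rewrite -(big_mkord xpredT (fun i => f (i%:Z - M%:Z))) /index_iota subn0.
rewrite -(big_map (fun i : nat => i%:Z - M%:Z) xpredT f); apply: perm_big.
rewrite uniq_perm ?fset_uniq //; first last.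
  by move=> j; rewrite seq_fsetE.
by rewrite map_inj_uniq ?iota_uniq // => i k; lia.
Qed.

Definition fsupp (f : int -> A) := exists M, forall j, M%:Z < `|j| -> f j = 0.

Lemma fsum_pair (I J : choiceType) (X : {fset I}) (Y : {fset J})
    (F : I * J -> A) :
  (forall i j, ~~ ((i \in X) && (j \in Y)) -> F (i, j) = 0) ->
  \sum_(p \in [set: I * J]) F p =
  \sum_(i \in [set: I]) \sum_(j \in [set: J]) F (i, j).
Proof.
move=> F0; rewrite (fsbigTE (X `*` Y)%fset); last first.
  by move=> [i j]; rewrite !inE /= => /F0.
rewrite (fsbigTE X); last first.
  by move=> i iX; rewrite fsbig1 // => j _; rewrite F0 // (negPf iX).
rewrite (eq_bigr (fun i => \sum_(j <- Y) F (i, j))); last first.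
  by move=> i _; apply: fsbigTE => j jY; rewrite F0 // (negPf jY) andbF.
rewrite -big_allpairs.
apply: perm_big; rewrite uniq_perm ?fset_uniq //.
  by apply: allpairs_uniq => // -[? ?] [? ?].
move=> [i j]; rewrite !inE /=; apply/andP/allpairsP => [[iX jY]|].
  by exists (i, j).
by case=> -[i' j'] /= [iX jY [-> ->]].
Qed.

Lemma fsum_mul (f g : int -> A) : fsupp f -> fsupp g ->
  (\sum_(j \in [set: int]) f j) * (\sum_(j \in [set: int]) g j) =
  \sum_(p \in [set: int * int]) f p.1 * g p.2.
Proof.
move=> [M f0] [M' g0].
have f0' i : i \notin window M -> f i = 0.
  by rewrite mem_window => ?; apply: f0; lia.
have g0' i : i \notin window M' -> g i = 0.
  by rewrite mem_window => ?; apply: g0; lia.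
rewrite (@fsum_pair _ _ (window M) (window M')) /=; last first.
  by move=> i j; rewrite negb_and => /orP[/f0'|/g0'] ->; rewrite ?mul0r ?mulr0.
rewrite (fsbigTE (window M) f) // (fsbigTE (window M') g) // big_distrl /=.
rewrite (fsbigTE (window M)); last first.
  by move=> i /f0' ->; rewrite fsbig1 // => j _; rewrite mul0r.
apply: eq_bigr => i _; rewrite big_distrr /= (fsbigTE (window M')) //.
by move=> j /g0' ->; rewrite mulr0.
Qed.

Lemma fsum_residues k (f : int -> A) : (0 < k)%N -> fsupp f ->
  \sum_(j \in [set: int]) f j =
  \sum_(r < k) \sum_(j \in [set: int]) f (j * k%:Z + r%:Z).
Proof.
move=> k0 [M f0].
have bij_h : bijective (fun p : 'I_k * int => p.2 * k%:Z + p.1%:Z).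
  have hk (j : int) : (`|(j %% k)%Z| < k)%N by lia.
  exists (fun j => (Ordinal (hk j), (j %/ k)%Z)) => [[r j]|j] /=; last first.
    by rewrite [RHS](divz_eq j k) gez0_abs // modz_ge0 //; lia.
  have jE : ((j * k%:Z + r%:Z) %/ k)%Z = j.
    by rewrite divzMDl ?divz_small ?addr0 //; have := ltn_ord r; lia.
  congr (_, _) => //; apply: val_inj => /=.
  by have := divz_eq (j * k%:Z + r%:Z) k; rewrite jE; lia.
rewrite (reindex_fsbigT _ _ bij_h).
rewrite (@fsum_pair _ _ [fset r | r : 'I_k]%fset (window M)).
  rewrite (fsbigTE [fset r | r : 'I_k]%fset); last by move=> r; rewrite !inE.
  apply: perm_big; rewrite uniq_perm ?fset_uniq ?index_enum_uniq // => r.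
  by rewrite mem_index_enum !inE.
move=> r j; rewrite !inE mem_window /= => jM; apply: f0; have := ltn_ord r.
by have [j0|j0] := lerP 0 j; nia.
Qed.

(** The change of variables behind the products of two theta series: on each
    coset of the lattice m + n even, the form m^2 + n^2 becomes diagonal
    again in the coordinates u, v. *)
Lemma fsum_parity_pair M (F : int * int -> A) :
  (forall i j, (M%:Z < `|i|) || (M%:Z < `|j|) -> F (i, j) = 0) ->
  \sum_(p \in [set: int * int]) F p =
  (\sum_(p \in [set: int * int]) F (p.1 + p.2, p.1 - p.2)) +
  (\sum_(p \in [set: int * int]) F (p.1 + p.2 + 1, p.1 - p.2)).
Proof.
move=> F0.
pose h (q : bool * (int * int)) :=
  (q.2.1 + q.2.2 + (q.1 : nat)%:Z, q.2.1 - q.2.2).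
have bij_h : bijective h.
  exists (fun p => (((p.1 + p.2) %% 2)%Z == 1,
                    (((p.1 + p.2) %/ 2)%Z, ((p.1 - p.2) %/ 2)%Z))).
    by move=> [b [u v]]; rewrite /h /=; congr (_, (_, _)); lia.
  by move=> [m n]; rewrite /h /=; congr (_, _); lia.
rewrite (reindex_fsbigT h _ bij_h).
rewrite (@fsum_pair _ _ [fset b | b : bool]%fset
                        (window M.+1 `*` window M.+1)%fset).
  rewrite (fsbigTE [fset b | b : bool]%fset); last by move=> r; rewrite !inE.
  rewrite (perm_big (index_enum bool)) /=; last first.
    rewrite uniq_perm ?fset_uniq ?index_enum_uniq // => r.
    by rewrite mem_index_enum !inE.
  rewrite big_bool addrC /h /=; congr (_ + _).
  by apply: eq_fsbigr => p _; rewrite addr0.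
move=> b [u v]; rewrite !inE /= !mem_window /h /= => uvM; apply: F0; lia.
Qed.

End IntSums.

(** * Jacobi's triple product *)

Section Theta.
Variables (A : comNzRingType).
Implicit Types a b q : A.

(** The triangular number j(j+1)/2. It is invariant under j -> -1-j, whence
    the same value in both branches. *)
Definition tri (j : int) : nat :=
  match j with Posz n => 'C(n.+1, 2) | Negz n => 'C(n.+1, 2) end.

Lemma triE j : (tri j)%:Z * 2 = j * (j + 1).
Proof.
have binE n : ('C(n.+1, 2) * 2)%N = (n * n.+1)%N.
  by rewrite mulnC -mul_bin_diag bin1 mulnC.
by case: j => n; rewrite /tri; have := binE n; nia.
Qed.

Definition tterm a b (j : int) := a ^+ tri j * b ^+ tri (- j).

(** Ramanujan's general theta function f(a, b). *)
Definition theta a b := \sum_(j \in [set: int]) tterm a b j.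

(** Multiplying the term of index j by a (ab)^m moves it to the index j + 1, up
    to the power (ab)^(m - j), which is the weight in Pascal's rule. *)
Lemma tterm_up a b (m n k : nat) : (k <= m + n)%N ->
  tterm a b (k.+1%:Z - n%:Z) * (a * b) ^+ (m + n - k) =
  tterm a b (k%:Z - n%:Z) * (a * (a * b) ^+ m).
Proof.
move=> kmn; rewrite /tterm !exprMn.
have := triE (k.+1%:Z - n%:Z); have := triE (k%:Z - n%:Z).
have := triE (- (k.+1%:Z - n%:Z)); have := triE (- (k%:Z - n%:Z)).
move=> E1 E2 E3 E4.
transitivity (a ^+ (tri (k.+1%:Z - n%:Z) + (m + n - k)) *
              b ^+ (tri (- (k.+1%:Z - n%:Z)) + (m + n - k))).
  by rewrite !exprD; ring.
transitivity (a ^+ (tri (k%:Z - n%:Z) + m.+1) *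
              b ^+ (tri (- (k%:Z - n%:Z)) + m)).
  by congr (_ ^+ _ * _ ^+ _); nia.
by rewrite !exprD exprS; ring.
Qed.

Lemma tterm_down a b (n k : nat) :
  tterm a b (k%:Z - n.+1%:Z) * (a * b) ^+ k =
  tterm a b (k%:Z - n%:Z) * (b * (a * b) ^+ n).
Proof.
rewrite /tterm !exprMn.
have := triE (k%:Z - n.+1%:Z); have := triE (k%:Z - n%:Z).
have := triE (- (k%:Z - n.+1%:Z)); have := triE (- (k%:Z - n%:Z)).
move=> E1 E2 E3 E4.
transitivity (a ^+ (tri (k%:Z - n.+1%:Z) + k) *
              b ^+ (tri (- (k%:Z - n.+1%:Z)) + k)).
  by rewrite !exprD; ring.
transitivity (a ^+ (tri (k%:Z - n%:Z) + n) *
              b ^+ (tri (- (k%:Z - n%:Z)) + n.+1)).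
  by congr (_ ^+ _ * _ ^+ _); nia.
by rewrite !exprD exprS; ring.
Qed.

(** Each further factor on the a-side amounts to the first Pascal rule, and each
    further factor on the b-side to the second one. *)
Lemma finite_jtp a b m n :
  (\prod_(i < m) (1 + a * (a * b) ^+ i)) *
  (\prod_(i < n) (1 + b * (a * b) ^+ i)) =
  \sum_(k < (m + n).+1) gbin (a * b) (m + n) k * tterm a b (k%:Z - n%:Z).
Proof.
elim: m n => [|m IH] n.
  elim: n => [|n IHn].
    by rewrite !big_ord0 big_ord_recl big_ord0 /tterm /= !mulr1 addr0.
  rewrite big_ord_recr /= mulrA {}IHn !add0n.
  rewrite [RHS]big_ord_recl /= gbin0 mul1r.
  rewrite [in RHS](eq_bigr (fun k : 'I_n.+1 =>
     (a * b) ^+ k.+1 * gbin (a * b) n k.+1 * tterm a b (k.+1%:Z - n.+1%:Z)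
     + gbin (a * b) n k * tterm a b (k%:Z - n%:Z))); last first.
    move=> k _; rewrite /bump leq0n add1n gbinS_alt mulrDl.
    congr (_ + _ * tterm a b _).
    lia.
  rewrite big_split /= addrA mulrDr mulr1 addrC; congr (_ + _).
  rewrite mulr_suml.
  transitivity (\sum_(k < n.+2) (a * b) ^+ k * gbin (a * b) n k *
                               tterm a b (k%:Z - n.+1%:Z)).
    rewrite [RHS]big_ord_recr /= gbin_small // mulr0 mul0r addr0.
    apply: eq_bigr => k _; rewrite -mulrA -tterm_down; ring.
  by rewrite big_ord_recl /= gbin0 !mul1r.
rewrite big_ord_recr /= mulrAC {}IH addSn.
rewrite [RHS]big_ord_recl /= gbin0 mul1r.
rewrite [in RHS](eq_bigr (fun k : 'I_(m + n).+1 =>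
   gbin (a * b) (m + n) k.+1 * tterm a b (k.+1%:Z - n%:Z)
   + gbin (a * b) (m + n) k * (tterm a b (k%:Z - n%:Z) * (a * (a * b) ^+ m))));
  last first.
  move=> k _; rewrite /bump leq0n add1n gbinS mulrDl -tterm_up -1?ltnS //; ring.
rewrite big_split /= addrA mulrDr mulr1; congr (_ + _); last first.
  by rewrite mulr_suml; apply: eq_bigr => k _; rewrite mulrA.
transitivity (\sum_(k < (m + n).+2) gbin (a * b) (m + n) k *
                               tterm a b (k%:Z - n%:Z)).
  by rewrite [RHS]big_ord_recr /= gbin_small // mul0r addr0.
by rewrite big_ord_recl /= gbin0 !mul1r.
Qed.

Variable N : nat.

Lemma tterm0 a b (j : int) : nilp N a -> nilp N b -> N%:Z <= `|j| ->
  tterm a b j = 0.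
Proof.
move=> a0 b0 jN; rewrite /tterm.
have E1 := triE j; have E2 := triE (- j).
have [j0|j0] := lerP 0 j.
  by rewrite (nilpX0 a0) ?mul0r //; nia.
by rewrite (nilpX0 b0) ?mulr0 //; nia.
Qed.

Lemma fsupp_tterm a b : nilp N a -> nilp N b -> fsupp (tterm a b).
Proof. by move=> a0 b0; exists N => j jN; apply: tterm0 => //; lia. Qed.

Lemma gbin_euler q n k : nilp N q -> (N <= k)%N -> (N + k <= n)%N ->
  gbin q n k * euler N q = 1.
Proof.
move=> q0 Nk kn; apply: (euler_cancel q0); rewrite mulr1.
rewrite mulrCA mulrA mulrC -[RHS](@poch_widen _ _ q _ n) //; last by lia.
rewrite -[RHS](@gbin_qfact _ q n k); last by lia.
rewrite /qfact !(@poch_widen _ N) //; last by lia.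
by rewrite mulrAC -mulrA mulrC -mulrA.
Qed.

(** In the finite identity with 2N factors on both sides, the terms with
    N <= |j| vanish, and for the others both k and 4N - k are at least N, so
    that the Gaussian binomial is the inverse of the Euler product. *)
Theorem jacobi_triple_product a b : nilp N a -> nilp N b ->
  theta a b = poch N (- a) (a * b) * poch N (- b) (a * b) * euler N (a * b).
Proof.
move=> a0 b0; have q0 : nilp N (a * b) by apply: nilpM.
have pE c : poch N (- c) (a * b) = \prod_(i < 2 * N) (1 + c * (a * b) ^+ i).
  rewrite -(@poch_widen _ _ _ _ (2 * N)) //; last by lia.
  by apply: eq_bigr => i _; rewrite mulNr opprK.
rewrite !pE finite_jtp mulr_suml /theta (fsbigTE (window (2 * N))); last first.
  by move=> j; rewrite mem_window => jN; apply: tterm0 => //; lia.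
rewrite sum_window addnn -mul2n; apply: eq_bigr => k _.
have [kN|kN] := lerP N%:Z `|k%:Z - (2 * N)%:Z|.
  by rewrite !tterm0 // mulr0 mul0r.
by rewrite mulrAC gbin_euler ?mul1r //; lia.
Qed.

End Theta.

(** * Theta functions as eta quotients *)

Section EtaQuotients.
Variables (A : comNzRingType) (N : nat).
Implicit Types a q y : A.

Local Notation P a q := (poch N a q).

Lemma poch_split2 a q : nilp N q -> P a q = P a (q ^+ 2) * P (a * q) (q ^+ 2).
Proof.
by move=> q0; rewrite (@poch_split _ _ 2) // !big_ord_recl big_ord0 !mulr1.
Qed.

Lemma poch_split3 a q : nilp N q ->
  P a q = P a (q ^+ 3) * P (a * q) (q ^+ 3) * P (a * q ^+ 2) (q ^+ 3).
Proof.
move=> q0; rewrite (@poch_split _ _ 3) // !big_ord_recl big_ord0 !mulr1.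
by rewrite mulrA.
Qed.

Lemma euler_split2 y : nilp N y -> euler N y = P y (y ^+ 2) * euler N (y ^+ 2).
Proof. by move=> y0; rewrite /euler (@poch_split2 y y) // -expr2. Qed.

Lemma euler_split3 y : nilp N y ->
  euler N y = P y (y ^+ 3) * P (y ^+ 2) (y ^+ 3) * euler N (y ^+ 3).
Proof. by move=> y0; rewrite /euler (@poch_split3 y y) // -expr2 -exprS. Qed.

(** Because (q; q^2)_oo (-q; q^2)_oo = (q^2; q^4)_oo, where (q; q^2)_oo is
    f_1 / f_2 and (q^2; q^4)_oo is f_2 / f_4. *)
Lemma poch_odd_neg y : nilp N y ->
  P (- y) (y ^+ 2) * euler N y * euler N (y ^+ 4) = euler N (y ^+ 2) ^+ 2.
Proof.
move=> y0; rewrite (@euler_split2 y) //.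
have E := poch_mulN N y (y ^+ 2).
have E2 : euler N (y ^+ 2) = P (y ^+ 2) (y ^+ 2 ^+ 2) * euler N (y ^+ 4).
  by rewrite [LHS]euler_split2 ?nilpX // -!exprM.
by rewrite [in RHS]expr2 {2}E2 -E; ring.
Qed.

Lemma euler_neg y : nilp N y ->
  euler N y * euler N (- y) * euler N (y ^+ 4) = euler N (y ^+ 2) ^+ 3.
Proof.
move=> y0; rewrite (@euler_split2 (- y)) ?nilpN // sqrrN [RHS]exprS.
by rewrite -poch_odd_neg //; ring.
Qed.

(** Ramanujan's psi(q), the sum of q^(n(n+1)/2) over n >= 0: the numbers
    2j^2 - j, for j in Z, are the triangular numbers. The more common
    f(1, q) / 2 is unavailable here, 1 not being nilpotent. *)
Definition psi y : A := theta y (y ^+ 3).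

Lemma psiE y : nilp N y -> psi y * euler N y = euler N (y ^+ 2) ^+ 2.
Proof.
move=> y0; rewrite -poch_odd_neg // /psi (@jacobi_triple_product _ N) ?nilpX //.
rewrite -exprS (@poch_split2 (- y) (y ^+ 2)) ?nilpX // -exprM.
have -> : - y * y ^+ 2 = - y ^+ 3 by ring.
ring.
Qed.

(** The factors whose exponent is divisible by 3 complete the triple product to
    products over all residues; the same device serves for f(q, q^5) and
    f(-q, -q^5) below. *)
Lemma theta12E y : nilp N y ->
  theta y (y ^+ 2) * euler N y * euler N (y ^+ 6) =
  euler N (y ^+ 2) * euler N (y ^+ 3) ^+ 2.
Proof.
move=> y0; rewrite (@jacobi_triple_product _ N) ?nilpX // -exprS.
have E1 : P y y * P (- y) y = euler N (y ^+ 2) by apply: poch_mulN.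
have E3 : euler N (y ^+ 3) * P (- y ^+ 3) (y ^+ 3) = euler N (y ^+ 6).
  by rewrite [LHS]poch_mulN -exprM.
rewrite -E3 -E1 (@poch_split3 (- y) y) // /euler.
have -> : - y * y = - y ^+ 2 by ring.
have -> : - y * y ^+ 2 = - y ^+ 3 by ring.
ring.
Qed.

Lemma theta15E y : nilp N y ->
  theta y (y ^+ 5) * (euler N y * euler N (y ^+ 4) * euler N (y ^+ 6)) =
  euler N (y ^+ 2) ^+ 2 * euler N (y ^+ 3) * euler N (y ^+ 12).
Proof.
move=> y0; rewrite (@jacobi_triple_product _ N) ?nilpX // -exprS.
have E1 := poch_odd_neg y0.
have E3 : P (- y ^+ 3) (y ^+ 6) * euler N (y ^+ 3) * euler N (y ^+ 12) =
          euler N (y ^+ 6) ^+ 2.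
  by have := poch_odd_neg (nilpX (isT : 0 < 3)%N y0); rewrite -!exprM.
have E135 : P (- y) (y ^+ 2) =
            P (- y) (y ^+ 6) * P (- y ^+ 3) (y ^+ 6) * P (- y ^+ 5) (y ^+ 6).
  rewrite [LHS]poch_split3 ?nilpX // -!exprM; congr (_ * P _ _ * P _ _); ring.
rewrite -E1 E135.
transitivity (P (- y) (y ^+ 6) * P (- y ^+ 5) (y ^+ 6) * euler N y *
  euler N (y ^+ 4) * euler N (y ^+ 6) ^+ 2); first by ring.
by rewrite -E3; ring.
Qed.

Lemma thetaN33E y : nilp N y ->
  theta (- y ^+ 3) (- y ^+ 3) * euler N (y ^+ 6) = euler N (y ^+ 3) ^+ 2.
Proof.
move=> y0; rewrite (@jacobi_triple_product _ N) ?nilpN ?nilpX // opprK.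
have -> : - y ^+ 3 * - y ^+ 3 = y ^+ 6 by ring.
have E : euler N (y ^+ 3) = P (y ^+ 3) (y ^+ 6) * euler N (y ^+ 6).
  by rewrite [LHS]euler_split2 ?nilpX // -!exprM.
by rewrite E; ring.
Qed.

Lemma thetaN12E y : nilp N y -> theta (- y) (- y ^+ 2) = euler N y.
Proof.
move=> y0; rewrite (@jacobi_triple_product _ N) ?nilpN ?nilpX // mulrNN !opprK.
by rewrite -exprS [RHS]euler_split3.
Qed.

Lemma thetaN15E y : nilp N y ->
  theta (- y) (- y ^+ 5) * euler N (y ^+ 2) * euler N (y ^+ 3) =
  euler N y * euler N (y ^+ 6) ^+ 2.
Proof.
move=> y0; rewrite (@jacobi_triple_product _ N) ?nilpN ?nilpX // mulrNN !opprK.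
rewrite -exprS [in RHS]euler_split2 // (@poch_split3 y (y ^+ 2)) ?nilpX //.
rewrite (@euler_split2 (y ^+ 3)) ?nilpX // -!exprM -!exprS; ring.
Qed.

End EtaQuotients.

(** * Dissections of theta series *)

Section ThetaIdentities.
Variables (A : comNzRingType) (N : nat).
Implicit Types y : A.

Lemma fsum_mull (J : choiceType) (X : {fset J}) (c : A) (f : J -> A) :
  (forall j, j \notin X -> f j = 0) ->
  c * (\sum_(j \in [set: J]) f j) = \sum_(j \in [set: J]) c * f j.
Proof.
move=> f0; rewrite (fsbigTE X f) // mulr_sumr (fsbigTE X) // => j /f0 ->.
by rewrite mulr0.
Qed.

Lemma oppz_bij : bijective (fun j : int => - j).
Proof. by exists (fun j => - j) => j; rewrite opprK. Qed.

Lemma tterm_pow y r s j :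
  tterm (y ^+ r) (y ^+ s) j = y ^+ (r * tri j + s * tri (- j)).
Proof. by rewrite /tterm -!exprM -exprD. Qed.

(** The exponents 2j^2 - j are sorted by j modulo 3. They are multiples of 3
    for j = 0 or 2 modulo 3, and these are the even and odd terms of
    f(q^3, q^6); for j = 1 - 3k they are 1 + 9(2k^2 - k). *)
Lemma psi_split y : nilp N y ->
  psi y = theta (y ^+ 3) (y ^+ 6) + y * psi (y ^+ 9).
Proof.
move=> y0; have T0 r s : (0 < r)%N -> (0 < s)%N ->
    fsupp (tterm (y ^+ r) (y ^+ s)).
  by move=> r0 s0; apply: (@fsupp_tterm _ N); rewrite nilpX.
have -> : psi y = \sum_(j \in [set: int]) tterm (y ^+ 1) (y ^+ 3) j by [].
rewrite (@fsum_residues _ 3 _ isT (T0 1%N 3%N isT isT)).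
rewrite [theta _ _](@fsum_residues _ 2 _ isT (T0 3%N 6%N isT isT)).
rewrite !big_ord_recl !big_ord0 /= !addr0.
rewrite -[bump 0 (bump 0 0)]/2%N -[bump 0 0]/1%N.
rewrite -addrA; congr (_ + _).
  by apply: eq_fsbigr => j _; rewrite !tterm_pow; congr (_ ^+ _);
    have := triE (j * 3%:Z + 0%:Z); have := triE (- (j * 3%:Z + 0%:Z));
    have := triE (j * 2%:Z + 0%:Z); have := triE (- (j * 2%:Z + 0%:Z)); lia.
rewrite addrC; congr (_ + _); last first.
  (* Index 3(-1-j) + 2 on the left matches index 2j + 1 on the right. *)
  have bij_h : bijective (fun j : int => - j - 1).
    by exists (fun j : int => - j - 1) => j; lia.
  have E (j : int) : (1 * tri ((- j - 1) * 3%:Z + 2%:Z)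
                      + 3 * tri (- ((- j - 1) * 3%:Z + 2%:Z)) =
             3 * tri (j * 2%:Z + 1%:Z) + 6 * tri (- (j * 2%:Z + 1%:Z)))%N.
    have := triE ((- j - 1) * 3%:Z + 2%:Z).
    have := triE (- ((- j - 1) * 3%:Z + 2%:Z)).
    have := triE (j * 2%:Z + 1%:Z); have := triE (- (j * 2%:Z + 1%:Z)); lia.
  rewrite (reindex_fsbigT _ _ bij_h); apply: eq_fsbigr => j _.
  by rewrite !tterm_pow E.
have E (j : int) : (1 * tri (- j * 3%:Z + 1%:Z)
                    + 3 * tri (- (- j * 3%:Z + 1%:Z)) =
                    (9 * tri j + 27 * tri (- j)).+1)%N.
  have := triE (- j * 3%:Z + 1%:Z); have := triE (- (- j * 3%:Z + 1%:Z)).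
  have := triE j; have := triE (- j); lia.
rewrite (reindex_fsbigT _ _ oppz_bij) /psi /theta -exprM.
rewrite (@fsum_mull _ (window N)); last first.
  by move=> j; rewrite mem_window => jN; apply: (@tterm0 _ N);
    rewrite ?nilpX //; lia.
by apply: eq_fsbigr => j _; rewrite !tterm_pow -exprS E.
Qed.

Lemma ttermN y r s j :
  tterm (- y ^+ r) (- y ^+ s) j =
  (-1) ^+ (tri j + tri (- j)) * y ^+ (r * tri j + s * tri (- j)).
Proof.
rewrite -tterm_pow /tterm [(- y ^+ r) ^+ _]exprNn [(- y ^+ s) ^+ _]exprNn exprD.
ring.
Qed.

Lemma sign_pow_eq y (m m' n n' : nat) : odd m = odd m' -> n = n' ->
  (-1) ^+ m * y ^+ n = (-1) ^+ m' * y ^+ n'.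
Proof. by move=> Em ->; rewrite -signr_odd Em signr_odd. Qed.

(** The left side is the sum of (-1)^n q^(3m^2 - 2m + 3n^2). The substitution
    m = u + v, n = u - v separates the variables of the terms with m + n even,
    with exponent (6u^2 - 2u) + (6v^2 - 2v); for m + n odd, m = u + v + 1 and
    n = u - v give 1 + (6u^2 + 4u) + (6v^2 + 4v). *)
Lemma theta15_theta33 y : nilp N y ->
  theta y (y ^+ 5) * theta (- y ^+ 3) (- y ^+ 3) =
  theta (- y ^+ 4) (- y ^+ 8) ^+ 2 + y * theta (- y ^+ 2) (- y ^+ 10) ^+ 2.
Proof.
move=> y0.
have T0 r s (j : int) : (0 < r)%N -> (0 < s)%N -> N%:Z < `|j| ->
    tterm (- y ^+ r) (- y ^+ s) j = 0.
  by move=> r0 s0 jN; apply: (@tterm0 _ N); rewrite ?nilpN ?nilpX // ltW.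
have T0' (j : int) : N%:Z < `|j| -> tterm y (y ^+ 5) j = 0.
  by move=> jN; apply: (@tterm0 _ N); rewrite ?nilpX // ltW.
have S0 r s : (0 < r)%N -> (0 < s)%N -> fsupp (tterm (- y ^+ r) (- y ^+ s)).
  by move=> r0 s0; exists N => j; apply: T0.
have S0' : fsupp (tterm y (y ^+ 5)) by exists N => j; apply: T0'.
rewrite [theta (- y ^+ 4) _ ^+ 2]expr2 [theta (- y ^+ 2) _ ^+ 2]expr2.
rewrite /theta (fsum_mul S0' (S0 3%N 3%N isT isT)).
rewrite (fsum_mul (S0 4%N 8%N isT isT) (S0 4%N 8%N isT isT)).
rewrite (fsum_mul (S0 2%N 10%N isT isT) (S0 2%N 10%N isT isT)).
rewrite (@fsum_parity_pair _ N); last first.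
  by move=> i j /= /orP[/T0'|] => [->|jN]; rewrite ?mul0r ?T0 ?mulr0.
congr (_ + _).
  have S (u v : int) : odd (tri (u - v) + tri (- (u - v))) =
                       odd (tri u + tri (- u) + (tri v + tri (- v))).
    have := triE (u - v); have := triE (- (u - v)); have := triE u.
    have := triE (- u); have := triE v; have := triE (- v).
    by move=> *; lia.
  have E (u v : int) : (1 * tri (u + v) + 5 * tri (- (u + v)) +
        (3 * tri (u - v) + 3 * tri (- (u - v))) =
      4 * tri u + 8 * tri (- u) + (4 * tri v + 8 * tri (- v)))%N.
    have := triE (u - v); have := triE (- (u - v)); have := triE u.
    have := triE (- u); have := triE v; have := triE (- v).
    by have := triE (u + v); have := triE (- (u + v)); lia.
  apply: eq_fsbigr => -[u v] _ /=; rewrite -[y in tterm y _]expr1 tterm_pow.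
  rewrite !ttermN mulrCA -exprD E mulrACA -!exprD.
  exact: sign_pow_eq.
(* The exponents 6u^2 + 4u of the odd coset become the 6u^2 - 4u of the theta
   function after u -> -u. *)
have bij_h : bijective (fun p : int * int => (- p.1, - p.2)).
  by exists (fun p : int * int => (- p.1, - p.2)) => -[u v] /=; rewrite !opprK.
rewrite (reindex_fsbigT _ _ bij_h) /=.
rewrite (@fsum_mull _ (window N `*` window N)%fset); last first.
  move=> [u v]; rewrite !inE negb_and /= !mem_window -!ltNge.
  by case/orP => /(T0 2%N 10%N _ isT isT) ->; rewrite ?mul0r ?mulr0.
have S (u v : int) : odd (tri (- u - - v) + tri (- (- u - - v))) =
                     odd (tri u + tri (- u) + (tri v + tri (- v))).
  have := triE (- u - - v); have := triE (- (- u - - v)); have := triE u.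
  have := triE (- u); have := triE v; have := triE (- v); lia.
have E (u v : int) : (1 * tri (- u + - v + 1) + 5 * tri (- (- u + - v + 1)) +
      (3 * tri (- u - - v) + 3 * tri (- (- u - - v))) =
    (2 * tri u + 10 * tri (- u) + (2 * tri v + 10 * tri (- v))).+1)%N.
  have := triE (- u - - v); have := triE (- (- u - - v)); have := triE u.
  have := triE (- u); have := triE v; have := triE (- v).
  have := triE (- u + - v + 1); have := triE (- (- u + - v + 1)); lia.
apply: eq_fsbigr => -[u v] _ /=; rewrite -[y in tterm y _]expr1 tterm_pow.
rewrite !ttermN mulrCA -exprD E [in RHS]mulrACA -!exprD [in RHS]mulrCA -exprS.
exact: sign_pow_eq.
Qed.

End ThetaIdentities.

(** * Dissections of eta quotients *)

Section Dissections.
Variables (A : comNzRingType) (N : nat).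
Implicit Types y w : A.

Local Notation f y k := (euler N (y ^+ k)).
Local Notation e y k := (inveuler N (y ^+ k)).

Lemma eulerX_inv k y : nilp N y -> (0 < k)%N -> f y k * e y k = 1.
Proof. by move=> y0 k0; apply: euler_inv; apply: nilpX. Qed.

(** Up to a series in q^2, the quotient f_3^3 / f_1 is the product
    f(q, q^5) f(-q^3, -q^3), whose even and odd parts are known. *)
Lemma core3_dissection y : nilp N y ->
  f y 3 ^+ 3 * inveuler N y =
  f y 4 ^+ 3 * f y 6 ^+ 2 * e y 2 ^+ 2 * e y 12 + y * f y 12 ^+ 3 * e y 4.
Proof.
move=> y0; have H k := @eulerX_inv k y y0; have H1 := euler_inv y0.
have H2 := H 2%N isT; have H4 := H 4%N isT; have H6 := H 6%N isT.
have H12 := H 12%N isT.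
have := theta15_theta33 y0.
have -> : theta y (y ^+ 5) =
    f y 2 ^+ 2 * f y 3 * f y 12 * (inveuler N y * e y 4 * e y 6).
  by rewrite -(theta15E y0); ring: H1 H4 H6.
have -> : theta (- y ^+ 3) (- y ^+ 3) = f y 3 ^+ 2 * e y 6.
  by rewrite -(thetaN33E y0); ring: H6.
have -> : theta (- y ^+ 4) (- y ^+ 8) = f y 4.
  by have := thetaN12E (nilpX (isT : 0 < 4)%N y0); rewrite -exprM.
have -> : theta (- y ^+ 2) (- y ^+ 10) = f y 2 * f y 12 ^+ 2 * e y 4 * e y 6.
  have := thetaN15E (nilpX (isT : 0 < 2)%N y0); rewrite -!exprM.
  rewrite -[(2 * 2)%N]/4%N -[(2 * 3)%N]/6%N -[(2 * 5)%N]/10%N -[(2 * 6)%N]/12%N.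
  by move=> <-; ring: H4 H6.
move=> /(congr1 (fun c => c * (e y 2 ^+ 2 * e y 12 * f y 4 * f y 6 ^+ 2))) E.
transitivity (f y 2 ^+ 2 * f y 3 * f y 12 * (inveuler N y * e y 4 * e y 6) *
  (f y 3 ^+ 2 * e y 6) * (e y 2 ^+ 2 * e y 12 * f y 4 * f y 6 ^+ 2)).
  by ring: H2 H4 H6 H12.
by rewrite E; ring: H2 H4 H6 H12.
Qed.

(** Since f_1(q) f_1(-q) and f_3(q) f_3(-q) are series in q^2, so is the ratio
    of f_1 / f_3^3 to the value of f_3^3 / f_1 at -q. *)
Lemma core3_inv_dissection y : nilp N y ->
  euler N y * e y 3 ^+ 3 =
  f y 2 ^+ 3 * e y 4 * f y 12 ^+ 3 * e y 6 ^+ 9 *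
  (f y 4 ^+ 3 * f y 6 ^+ 2 * e y 2 ^+ 2 * e y 12 - y * f y 12 ^+ 3 * e y 4).
Proof.
move=> y0; have H k := @eulerX_inv k y y0.
have H3 := H 3%N isT; have H4 := H 4%N isT; have H6 := H 6%N isT.
have H12 := H 12%N isT.
have H1' := euler_inv (nilpN y0).
have H3' : euler N (- y ^+ 3) * inveuler N (- y ^+ 3) = 1.
  by apply: euler_inv; rewrite nilpN ?nilpX.
have even k : odd k = false -> (- y) ^+ k = y ^+ k.
  by move=> k0; rewrite exprNn -signr_odd k0 expr0 mul1r.
have := core3_dissection (nilpN y0).
rewrite (even 2%N) // (even 4%N) // (even 6%N) // (even 12%N) //.
have -> : (- y) ^+ 3 = - y ^+ 3 by ring.
rewrite !mulNr => <-.
have E1 := euler_neg y0.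
have E3 : f y 3 * euler N (- y ^+ 3) * f y 12 = f y 6 ^+ 3.
  by have := euler_neg (nilpX (isT : 0 < 3)%N y0); rewrite -!exprM.
transitivity (euler N y * e y 3 ^+ 3 * f y 6 ^+ 3 ^+ 3 * e y 6 ^+ 9).
  by ring: H6.
rewrite -E3 -E1; ring: H3 H4 H1'.
Qed.

Section CubeRoot.
Variable w : A.
Hypothesis w3 : w ^+ 2 + w + 1 = 0.

Let w2E : w ^+ 2 = - 1 - w.
Proof. by rewrite -[LHS](addrK (w + 1)) addrA w3; ring. Qed.

Let w3E : w ^+ 3 = 1.
Proof. by rewrite exprS w2E; ring: w2E. Qed.

(** Here (1 - x) (1 - w x) (1 - w^2 x) = 1 - x^3, applied to each factor. *)
Lemma poch_cubic z q :
  poch N z q * poch N (w * z) q * poch N (w ^+ 2 * z) q =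
  poch N (z ^+ 3) (q ^+ 3).
Proof.
rewrite /poch -!big_split; apply: eq_bigr => i _ /=.
rewrite exprAC; ring: w2E.
Qed.

Lemma euler_cubic y : nilp N y ->
  euler N y * euler N (w * y) * euler N (w ^+ 2 * y) * f y 9 = f y 3 ^+ 4.
Proof.
move=> y0.
have E1 : euler N y = poch N y (y ^+ 3) * poch N (y ^+ 2) (y ^+ 3) * f y 3.
  exact: euler_split3.
have E2 : euler N (w * y) = poch N (w * y) (y ^+ 3) *
    poch N (w ^+ 2 * y ^+ 2) (y ^+ 3) * f y 3.
  rewrite euler_split3 ?nilpM //.
  have -> : (w * y) ^+ 3 = y ^+ 3 by ring: w3E.
  by rewrite exprMn.
have E3 : euler N (w ^+ 2 * y) = poch N (w ^+ 2 * y) (y ^+ 3) *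
    poch N (w * y ^+ 2) (y ^+ 3) * f y 3.
  rewrite euler_split3 ?nilpM //.
  have -> : (w ^+ 2 * y) ^+ 3 = y ^+ 3 by ring: w3E.
  by have -> : (w ^+ 2 * y) ^+ 2 = w * y ^+ 2 by ring: w3E.
have E : f y 3 = poch N (y ^+ 3) (y ^+ 9) * poch N (y ^+ 6) (y ^+ 9) * f y 9.
  by rewrite [LHS]euler_split3 ?nilpX // -!exprM.
have C1 := poch_cubic y (y ^+ 3); rewrite -[y ^+ 3 ^+ 3]exprM in C1.
have C2 := poch_cubic (y ^+ 2) (y ^+ 3); rewrite -!exprM in C2.
rewrite [RHS]exprS {1}E -[in RHS]C1 -[in RHS]C2 E1 E2 E3; ring.
Qed.

Lemma psi_cubic y : nilp N y ->
  psi y * psi (w * y) * psi (w ^+ 2 * y) =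
  f y 6 ^+ 8 * e y 18 ^+ 2 * e y 3 ^+ 4 * f y 9.
Proof.
move=> y0; have H k := @eulerX_inv k y y0.
have H18 := H 18%N isT; have H3 := H 3%N isT.
have E1 := psiE y0; have E2 := psiE (nilpM w y0).
have E3 := psiE (nilpM (w ^+ 2) y0).
have C := euler_cubic y0.
have C2 : f y 2 * euler N ((w * y) ^+ 2) * euler N ((w ^+ 2 * y) ^+ 2) * f y 18
   = f y 6 ^+ 4.
  have := euler_cubic (nilpX (isT : 0 < 2)%N y0); rewrite -!exprM.
  have -> : (w * y) ^+ 2 = w ^+ 2 * y ^+ 2 by ring.
  have -> : (w ^+ 2 * y) ^+ 2 = w * y ^+ 2 by ring: w3E.
  by move=> <-; rewrite -[(2 * 9)%N]/18%N; ring.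
transitivity (psi y * psi (w * y) * psi (w ^+ 2 * y) * f y 3 ^+ 4 * e y 3 ^+ 4).
  by ring: H3.
rewrite -C.
transitivity ((psi y * euler N y) * (psi (w * y) * euler N (w * y)) *
  (psi (w ^+ 2 * y) * euler N (w ^+ 2 * y)) * f y 9 * e y 3 ^+ 4).
  by ring.
rewrite E1 E2 E3.
transitivity (f y 6 ^+ 4 ^+ 2 * e y 18 ^+ 2 * e y 3 ^+ 4 * f y 9); last first.
  by rewrite -exprM.
rewrite -C2; ring: H18.
Qed.

(** Write psi(q) = a + q b with a and b series in q^3. Then psi(w q) and
    psi(w^2 q) are a + w q b and a + w^2 q b, so that their product with psi(q)
    is a^3 + q^3 b^3; as it is an eta quotient by [psi_cubic], the cofactor
    a^2 - q a b + q^2 b^2 of psi(q) is 1 / psi(q) up to an eta quotient. *)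
Lemma inv_psi_dissection y : nilp N y ->
  euler N y * e y 2 ^+ 2 =
  f y 3 ^+ 4 * f y 18 ^+ 2 * e y 6 ^+ 8 * e y 9 *
  (theta (y ^+ 3) (y ^+ 6) ^+ 2 - y * (theta (y ^+ 3) (y ^+ 6) * psi (y ^+ 9)) +
   y ^+ 2 * psi (y ^+ 9) ^+ 2).
Proof.
move=> y0; have H k := @eulerX_inv k y y0; have H1 := euler_inv y0.
have H2 := H 2%N isT; have H3 := H 3%N isT; have H6 := H 6%N isT.
have H9 := H 9%N isT; have H18 := H 18%N isT.
have P0 := psiE y0; have P := psi_split y0; have := psi_cubic y0.
have P1 := psi_split (nilpM w y0); have P2 := psi_split (nilpM (w ^+ 2) y0).
have cube_power c k : c ^+ 3 = 1 -> (c * y) ^+ (3 * k) = y ^+ (3 * k).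
  by move=> c3; rewrite exprMn exprM c3 expr1n mul1r.
have w6 : w ^+ 2 ^+ 3 = 1 by rewrite exprAC w3E expr1n.
move: P1 P2; rewrite (cube_power _ 1%N w3E) (cube_power _ 2%N w3E).
rewrite (cube_power _ 3%N w3E) (cube_power _ 1%N w6) (cube_power _ 2%N w6).
rewrite (cube_power _ 3%N w6).
rewrite -[(3 * 1)%N]/3%N -[(3 * 2)%N]/6%N -[(3 * 3)%N]/9%N.
move=> P1 P2.
set a := theta _ _ in P P1 P2 *; set b := psi (y ^+ 9) in P P1 P2 *.
have -> : psi y * psi (w * y) * psi (w ^+ 2 * y) =
          psi y * (a ^+ 2 - y * (a * b) + y ^+ 2 * b ^+ 2).
  by rewrite P1 P2; ring: w2E.
have -> : psi y = f y 2 ^+ 2 * inveuler N y by rewrite -P0; ring: H1.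
set D := a ^+ 2 - _ + _ => E.
transitivity (euler N y * e y 2 ^+ 2 *
  (f y 6 ^+ 8 * e y 18 ^+ 2 * e y 3 ^+ 4 * f y 9) *
  (f y 3 ^+ 4 * f y 18 ^+ 2 * e y 6 ^+ 8 * e y 9)).
  by ring: H3 H6 H9 H18.
by rewrite -E; ring: H1 H2.
Qed.

End CubeRoot.
End Dissections.

(** * The six components of the generating function *)

Section MainDissection.
Variables (A : comNzRingType) (N : nat) (w y : A).
Hypotheses (w3 : w ^+ 2 + w + 1 = 0) (y0 : nilp N y).

Local Notation z := (y ^+ 6).
Local Notation F k := (euler N (z ^+ k)).
Local Notation E k := (inveuler N (z ^+ k)).

(** The three terms of 1 / (psi(q) f_3^3) given by [inv_psi_dissection] are,
    in Q = q^3, f_3^3 / f_1 over f_2^6, then - q f_6^3 / f_2^7, and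
    q^2 f_6^6 / f_2^8 times f_1 / f_3^3. The middle one is a series in Q^2 and
    thus leaves the exponents 4 modulo 6 empty; the other two are split into
    even and odd parts by the dissections of f_3^3 / f_1 and f_1 / f_3^3. *)
Theorem eta_quotient_dissection :
  euler N y * inveuler N (y ^+ 2) ^+ 2 * inveuler N (y ^+ 3) ^+ 3 =
    F 2 ^+ 3 * F 3 ^+ 2 * inveuler N z ^+ 8 * E 6
  - y * (F 3 ^+ 3 * inveuler N z ^+ 7)
  + y ^+ 2 * (F 2 ^+ 2 * F 6 ^+ 2 * inveuler N z ^+ 7 * E 3)
  + y ^+ 3 * (F 6 ^+ 3 * E 2 * inveuler N z ^+ 6)
  - y ^+ 5 * (F 6 ^+ 6 * inveuler N z ^+ 5 * E 2 ^+ 2 * E 3 ^+ 3).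
Proof.
have -> : z ^+ 2 = y ^+ 12 by rewrite -exprM.
have -> : z ^+ 3 = y ^+ 18 by rewrite -exprM.
have -> : z ^+ 6 = y ^+ 36 by rewrite -exprM.
pose f k := euler N (y ^+ k); pose e k := inveuler N (y ^+ k).
rewrite -/(f 12%N) -/(f 18%N) -/(f 36%N) -/(e 2%N) -/(e 3%N).
rewrite -/(e 6%N) -/(e 12%N) -/(e 18%N) -/(e 36%N).
have y3 : nilp N (y ^+ 3) by apply: nilpX.
have H k : (0 < k)%N -> f k * e k = 1 by apply: eulerX_inv.
have H3 := H 3%N isT; have H6 := H 6%N isT; have H9 := H 9%N isT.
have H12 := H 12%N isT; have H18 := H 18%N isT; have H36 := H 36%N isT.
have a_eq : theta (y ^+ 3) (y ^+ 6) = f 6%N * f 9%N ^+ 2 * e 3%N * e 18%N.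
  have E : theta (y ^+ 3) (y ^+ 6) * f 3%N * f 18%N = f 6%N * f 9%N ^+ 2.
    by have := theta12E y3; rewrite -!exprM.
  by rewrite -E; ring: H3 H18.
have b_eq : psi (y ^+ 9) = f 18%N ^+ 2 * e 9%N.
  have E : psi (y ^+ 9) * f 9%N = f 18%N ^+ 2.
    by have := psiE (nilpX (isT : 0 < 9)%N y0); rewrite -!exprM.
  by rewrite -E; ring: H9.
have core : f 9%N ^+ 3 * e 3%N =
    f 12%N ^+ 3 * f 18%N ^+ 2 * e 6%N ^+ 2 * e 36%N +
    y ^+ 3 * f 36%N ^+ 3 * e 12%N.
  by have := core3_dissection y3; rewrite -!exprM.
have core_inv : f 3%N * e 9%N ^+ 3 =
    f 6%N ^+ 3 * e 12%N * f 36%N ^+ 3 * e 18%N ^+ 9 *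
    (f 12%N ^+ 3 * f 18%N ^+ 2 * e 6%N ^+ 2 * e 36%N -
     y ^+ 3 * f 36%N ^+ 3 * e 12%N).
  by have := core3_inv_dissection y3; rewrite -!exprM.
have -> : euler N y * e 2%N ^+ 2 =
    f 3%N ^+ 4 * f 18%N ^+ 2 * e 6%N ^+ 8 * e 9%N *
    (theta (y ^+ 3) (y ^+ 6) ^+ 2 - y * (theta (y ^+ 3) (y ^+ 6) * psi (y ^+ 9))
     + y ^+ 2 * psi (y ^+ 9) ^+ 2) by exact: (inv_psi_dissection w3).
rewrite a_eq b_eq.
transitivity (f 9%N ^+ 3 * e 3%N * e 6%N ^+ 6 - y * (f 18%N ^+ 3 * e 6%N ^+ 7) +
              y ^+ 2 * (f 3%N * e 9%N ^+ 3 * f 18%N ^+ 6 * e 6%N ^+ 8)).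
  by ring: H3 H6 H9 H18.
rewrite core core_inv; ring: H6 H12 H18 H36.
Qed.

End MainDissection.

(** * Positivity of the components *)

Section Positivity.
Variables (A : comNzRingType) (N : nat).
Implicit Types (z a : A) (p : {poly int}).

Definition peval z p : A := (map_poly intr p).[z].

Lemma pevalM z p r : peval z (p * r) = peval z p * peval z r.
Proof. by rewrite /peval rmorphM hornerM. Qed.

(** The witness is a polynomial and not a family of elements of the ring, since
    a nilpotent z does not determine the coefficients of its series; they are
    recovered only in the truncated polynomial ring. The positive constant
    term is the invariant that survives products and gives strict positivity
    in the end. *)
Definition nonneg_in z a := exists p,
  [/\ forall i, 0 <= p`_i, 0 < p`_0 & a = peval z p].

Lemma nonneg_inM z a b : nonneg_in z a -> nonneg_in z b -> nonneg_in z (a * b).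
Proof.
move=> [p [p0 p00 ->]] [r [r0 r00 ->]]; exists (p * r).
rewrite pevalM; split=> // [i|]; last by rewrite coef0M mulr_gt0.
by rewrite coefM sumr_ge0 // => j _; rewrite mulr_ge0.
Qed.

Lemma nonneg_in1 z : nonneg_in z 1.
Proof.
exists 1; split=> [i||]; first by rewrite coef1 ler0n.
  by rewrite coef1.
by rewrite /peval rmorph1 hornerC.
Qed.

Lemma nonneg_inX z a k : nonneg_in z a -> nonneg_in z (a ^+ k).
Proof.
move=> pa; elim: k => [|k IH]; first exact: nonneg_in1.
by rewrite exprS; apply: nonneg_inM.
Qed.

Lemma nonneg_in_prod z (I : Type) (r : seq I) (F : I -> A) :
  (forall i, nonneg_in z (F i)) -> nonneg_in z (\prod_(i <- r) F i).
Proof.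
by move=> F0; apply: big_ind => //; [apply: nonneg_in1 | apply: nonneg_inM].
Qed.

Lemma nonneg_in_sum z (I : eqType) (r : seq I) (F : I -> nat) i0 :
  i0 \in r -> F i0 = 0%N -> nonneg_in z (\sum_(i <- r) z ^+ F i).
Proof.
move=> i0r Fi0; exists (\sum_(i <- r) 'X^(F i)); split.
- move=> k; rewrite coef_sum sumr_ge0 // => i _; rewrite coefXn.
  by case: eqP.
- rewrite coef_sum (big_rem i0) //= Fi0 coefXn /= ltr_wpDr ?sumr_ge0 // => i _.
  by rewrite coefXn; case: eqP.
rewrite /peval rmorph_sum horner_sum; apply: eq_bigr => i _ /=.
by rewrite map_polyXn hornerXn.
Qed.

Lemma nonneg_in_geom z k : (0 < N)%N -> nonneg_in z (geom N (z ^+ k)).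
Proof.
case: N => // M _; rewrite /geom (eq_bigr (fun i : 'I_M.+1 => z ^+ (k * i))).
  by apply: (@nonneg_in_sum _ _ _ _ ord0); rewrite ?mem_index_enum // muln0.
by move=> i _; rewrite exprM.
Qed.

Lemma nonneg_in_inveuler z k : (0 < N)%N -> nonneg_in z (inveuler N (z ^+ k)).
Proof.
move=> N0; apply: nonneg_in_prod => i; rewrite -exprS -exprM.
exact: nonneg_in_geom.
Qed.

Lemma nonneg_in_theta z r s : (0 < r)%N -> (0 < s)%N -> nilp N z ->
  nonneg_in z (theta (z ^+ r) (z ^+ s)).
Proof.
move=> r0 s0 z0; rewrite /theta (fsbigTE (window N)); last first.
  by move=> j; rewrite mem_window => jN; apply: (@tterm0 _ N);
    rewrite ?nilpX //; lia.
rewrite (eq_bigr (fun j => z ^+ (r * tri j + s * tri (- j)))); last first.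
  by move=> j _; rewrite tterm_pow.
by apply: (@nonneg_in_sum _ _ _ _ 0); rewrite ?mem_window //= !muln0.
Qed.

(** Here f_3 / f_1 is the product of the factors 1 + q^i + q^(2i). *)
Lemma nonneg_in_euler3 z k : nilp N z -> (0 < k)%N ->
  nonneg_in z (euler N (z ^+ (3 * k)) * inveuler N (z ^+ k)).
Proof.
move=> z0 k0.
have -> : euler N (z ^+ (3 * k)) * inveuler N (z ^+ k) =
  \prod_(i < N) (\sum_(j <- iota 0 3) z ^+ (k * i.+1 * j)).
  apply: (@euler_cancel _ N (z ^+ k)); first exact: nilpX.
  rewrite mulrCA euler_inv ?nilpX // mulr1 /euler /poch -big_split.
  apply: eq_bigr => i _ /=; rewrite !big_cons big_nil.
  rewrite -!exprS -!exprM muln0 muln1 -mulnA [(3 * _)%N]mulnC [in LHS]exprM.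
  by rewrite [z ^+ (_ * 2)]exprM; ring.
apply: nonneg_in_prod => i.
apply: (@nonneg_in_sum _ _ _ (fun j => k * i.+1 * j)%N 0%N) => //.
by rewrite muln0.
Qed.

Definition positive_in z a :=
  exists2 p : {poly int}, forall i, (i < N)%N -> 0 < p`_i & a = peval z p.

(** One factor 1 / (1 - z) turns coefficients into their partial sums, which are
    at least the constant term. *)
Lemma nonneg_positive_in z a k : (0 < N)%N -> (0 < k)%N -> nonneg_in z a ->
  positive_in z (a * inveuler N z ^+ k).
Proof.
move=> N0; case: k => // k _ pa; rewrite exprS.
have invE : inveuler N z = geom N z * \prod_(1 <= i < N) geom N (z ^+ i.+1).
  rewrite /inveuler /invpoch -(big_mkord xpredT (fun i => geom N (z * z ^+ i))).
  rewrite big_ltn // mulr1; congr (_ * _); apply: eq_bigr => i _.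
  by rewrite exprS.
rewrite {1}invE; set b := \prod_(_ <= _ < _) _.
have pb : nonneg_in z b by apply: nonneg_in_prod => i; apply: nonneg_in_geom.
have [p [p0 p00 E]] : nonneg_in z (a * b * inveuler N z ^+ k).
  by rewrite -[z in inveuler _ z]expr1; apply: nonneg_inM;
    [apply: nonneg_inM | apply/nonneg_inX/nonneg_in_inveuler].
exists (p * \poly_(i < N) 1) => [m mN|].
  rewrite coefM big_ord_recl /= subn0 coef_poly mN mulr1.
  rewrite ltr_wpDr // sumr_ge0 //.
  by move=> j _; rewrite mulr_ge0 // coef_poly; case: ifP.
rewrite pevalM -E [peval z (\poly_(_ < _) _)](_ : _ = geom N z); first by ring.
rewrite /peval poly_def rmorph_sum horner_sum; apply: eq_bigr => i _.
by rewrite /= scale1r map_polyXn hornerXn.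
Qed.

(** In the variable z, the components are products of
    psi(z^k) = f_(2k)^2 / f_k, of f(z, z^2) = f_2 f_3^2 / (f_1 f_6), of
    f_(3k) / f_k and of 1 / f_k, with at least one factor 1 / f_1 to spare. *)
Section Components.
Variable z : A.
Hypotheses (z0 : nilp N z) (N0 : (0 < N)%N).

Local Notation F k := (euler N (z ^+ k)).
Local Notation E k := (inveuler N (z ^+ k)).

Let H k : (0 < k)%N -> F k * E k = 1. Proof. exact: eulerX_inv. Qed.

Let pos_inv k : nonneg_in z (E k). Proof. exact: nonneg_in_inveuler. Qed.

Let pos_psi k : (0 < k)%N -> nonneg_in z (psi (z ^+ k)).
Proof.
move=> k0; rewrite /psi -exprM.
by apply: nonneg_in_theta; rewrite ?muln_gt0 ?k0.
Qed.

Let psi_quot k : (0 < k)%N -> F (k * 2) ^+ 2 * E k = psi (z ^+ k).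
Proof.
by move=> k0; rewrite exprM -psiE ?nilpX // -mulrA H // mulr1.
Qed.

Let theta12_quot : F 2 * F 3 ^+ 2 * inveuler N z * E 6 = theta z (z ^+ 2).
Proof.
rewrite -theta12E //; ring: (euler_inv z0) (H (isT : 0 < 6)%N).
Qed.

Lemma component0_positive :
  positive_in z (F 2 ^+ 3 * F 3 ^+ 2 * inveuler N z ^+ 8 * E 6).
Proof.
have -> : F 2 ^+ 3 * F 3 ^+ 2 * inveuler N z ^+ 8 * E 6 =
  theta (z ^+ 1) (z ^+ 2) * psi (z ^+ 1) * inveuler N z ^+ 6.
  by rewrite -theta12_quot -psi_quot //; ring.
apply: nonneg_positive_in => //.
by apply: nonneg_inM; [apply: nonneg_in_theta | apply: pos_psi].
Qed.

Lemma component1_positive :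
  positive_in z (F 3 ^+ 3 * inveuler N z ^+ 7).
Proof.
have -> : F 3 ^+ 3 * inveuler N z ^+ 7 =
  (F (3 * 1) * E 1) ^+ 3 * inveuler N z ^+ 4 by ring.
by apply: nonneg_positive_in => //; apply/nonneg_inX/nonneg_in_euler3.
Qed.

Lemma component2_positive :
  positive_in z (F 2 ^+ 2 * F 6 ^+ 2 * inveuler N z ^+ 7 * E 3).
Proof.
have -> : F 2 ^+ 2 * F 6 ^+ 2 * inveuler N z ^+ 7 * E 3 =
  psi (z ^+ 1) * psi (z ^+ 3) * inveuler N z ^+ 6.
  by rewrite -!psi_quot //; ring.
by apply: nonneg_positive_in => //; apply: nonneg_inM; apply: pos_psi.
Qed.

Lemma component3_positive :
  positive_in z (F 6 ^+ 3 * E 2 * inveuler N z ^+ 6).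
Proof.
have -> : F 6 ^+ 3 * E 2 * inveuler N z ^+ 6 =
  (F (3 * 2) * E 2) ^+ 3 * psi (z ^+ 1) * inveuler N z ^+ 5.
  rewrite -!psi_quot //; ring: (H (isT : 0 < 2)%N).
apply: nonneg_positive_in => //; apply: nonneg_inM; last exact: pos_psi.
exact/nonneg_inX/nonneg_in_euler3.
Qed.

Lemma component5_positive :
  positive_in z (F 6 ^+ 6 * inveuler N z ^+ 5 * E 2 ^+ 2 * E 3 ^+ 3).
Proof.
have -> : F 6 ^+ 6 * inveuler N z ^+ 5 * E 2 ^+ 2 * E 3 ^+ 3 =
  psi (z ^+ 3) ^+ 3 * E 2 ^+ 2 * inveuler N z ^+ 5.
  by rewrite -!psi_quot //; ring.
apply: nonneg_positive_in => //.
by apply: nonneg_inM; apply: nonneg_inX; [apply: pos_psi | apply: pos_inv].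
Qed.

End Components.
End Positivity.

(** * Power series modulo a power of the variable *)

Section Truncation.
Variable n : nat.
Let N := n.+1.
Let B := {poly %/ ('X^N : {poly algC})}.

Lemma coef_in_qpolyXn (p : {poly algC}) i : (i < N)%N ->
  (in_qpoly 'X^N p : {poly algC})`_i = p`_i.
Proof.
move=> iN; rewrite /= mk_monic_Xn /=.
rewrite {2}(Pdiv.RingMonic.rdivp_eq (monicXn _ N) p) coefD coefMXn iN add0r.
by [].
Qed.

Lemma eq_in_qpolyXn (p r : {poly algC}) :
  (forall i, (i < N)%N -> p`_i = r`_i) -> in_qpoly 'X^N p = in_qpoly 'X^N r.
Proof.
move=> pr; apply/npolyP => i; have [iN|Ni] := ltnP i N.
  by rewrite !coef_in_qpolyXn // pr.
by rewrite !big_coef_npoly // mk_monic_Xn size_polyXn.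
Qed.

(** Integers are embedded in algebraic numbers so that the target also contains
    a primitive cube root of unity. *)
Definition reduce (p : {poly int}) : B := in_qpoly 'X^N (map_poly intr p).
HB.instance Definition _ := GRing.RMorphism.copy reduce
  (in_qpoly ('X^N : {poly algC}) \o map_poly intr).

(** Coefficients of index less than N can be read off from the reduction. *)
Lemma reduce_inj (p r : {poly int}) i : (i < N)%N -> reduce p = reduce r ->
  p`_i = r`_i.
Proof.
move=> iN /(congr1 (fun u : B => (u : {poly algC})`_i)).
by rewrite !coef_in_qpolyXn // !coef_map /= => /intr_inj.
Qed.

Lemma eq_reduce (p r : {poly int}) :
  (forall i, (i < N)%N -> p`_i = r`_i) -> reduce p = reduce r.
Proof.
by move=> pr; apply: eq_in_qpolyXn => i iN; rewrite !coef_map /= pr.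
Qed.

Lemma nilp_reduceX : nilp N (reduce 'X).
Proof.
rewrite /nilp -rmorphXn -(rmorph0 reduce); apply/eqP/eq_reduce => i iN.
by rewrite coefXn coef0 ltn_eqF.
Qed.

Lemma peval_reduce k (p : {poly int}) :
  peval (reduce 'X ^+ k) p = reduce (p \Po 'X^k).
Proof.
rewrite /peval; elim/poly_ind: p => [|p c IH].
  by rewrite !rmorph0 horner0.
rewrite rmorphD rmorphM /= map_polyX map_polyC hornerMXaddC IH.
rewrite comp_polyD comp_polyM comp_polyX comp_polyC rmorphD rmorphM rmorphXn.
by congr (_ + _); rewrite -[c in RHS]intz /= !rmorph_int.
Qed.

Lemma cube_root_unity : exists w : B, w ^+ 2 + w + 1 = 0.
Proof.
have [u] := @solve_monicpoly algC 2%N (fun=> -1) isT.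
rewrite !big_ord_recl big_ord0 expr0 mulr1 addr0 => uE.
exists (in_qpoly 'X^N u%:P).
rewrite -rmorphXn -(rmorph1 (in_qpoly ('X^N : {poly algC}))) -!rmorphD /=.
rewrite -(rmorphXn (@polyC algC)) /= -polyCD -polyCD.
have -> : u ^+ 2 + u + 1 = 0 by rewrite uE expr1; ring.
by rewrite polyC0 rmorph0.
Qed.

Definition fps_reduce (g : fps int) : B := reduce (fps_trunc N g).

Lemma fps_reduceM g h : fps_reduce (g * h) = fps_reduce g * fps_reduce h.
Proof.
rewrite /fps_reduce -rmorphM; apply: eq_reduce => i iN.
by rewrite coef_fps_trunc // [fcoef _ _](fps_mul_trunc _ _ iN).
Qed.

Lemma fps_reduce1 : fps_reduce 1 = 1.
Proof.
rewrite /fps_reduce -(rmorph1 reduce); apply: eq_reduce => i iN.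
by rewrite coef_fps_trunc // fcoef1 coef1.
Qed.

Lemma fps_reduceX g k : fps_reduce (g ^+ k) = fps_reduce g ^+ k.
Proof.
elim: k => [|k IH]; first exact: fps_reduce1.
by rewrite (exprS g) fps_reduceM IH -(exprS (fps_reduce g)).
Qed.

Lemma fps_reduce_subXn k : fps_reduce (1 - fpsX ^+ k) = 1 - reduce 'X ^+ k.
Proof.
rewrite /fps_reduce -rmorphXn -(rmorph1 reduce) -rmorphB.
apply: eq_reduce => i iN.
by rewrite coef_fps_trunc // fcoefB fcoef1 fcoefXn coefB coef1 coefXn.
Qed.

Lemma fps_reduce_eta M k : (0 < k)%N -> (N <= M)%N ->
  fps_reduce (\prod_(1 <= m < M.+1) (1 - fpsX ^+ (k * m))) =
  euler N (reduce 'X ^+ k).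
Proof.
move=> k0 NM; rewrite (big_morph _ fps_reduceM fps_reduce1).
rewrite big_add1 big_mkord /= /euler -(@poch_widen _ _ _ _ M) //; last first.
  exact/nilpX/nilp_reduceX.
by apply: eq_bigr => i _; rewrite fps_reduce_subXn -exprS -exprM.
Qed.

End Truncation.

(** * Signs of the coefficients *)

Lemma coef_Xn_comp_Xn (p : {poly int}) k i q r : (0 < k)%N -> (r < k)%N ->
  (i < k)%N -> ('X^r * (p \Po 'X^k))`_(q * k + i) = if i == r then p`_q else 0.
Proof.
move=> k0 rk ik; rewrite coefXnM coef_comp_poly_Xn //.
have [-> | ir] := eqVneq i r.
  by rewrite ltnNge leq_addl /= addnK dvdn_mull // mulnK.
case: ifP => // /negbT; rewrite -leqNgt => rqi.
case: ifP => // /dvdnP[d dE]; case/eqP: ir.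
have E : (q * k + i = d * k + r)%N by lia.
by have := congr1 (modn^~ k) E; rewrite !modnMDl !modn_small.
Qed.

Theorem theorem1p2 (c : nat -> int)
    (c_def : fps_is_infprod
       (fun m => (1 - fpsX ^+ m) /
          ((1 - fpsX ^+ (2 * m)) ^+ 2 * (1 - fpsX ^+ (3 * m)) ^+ 3))
       (Fps c))
    (n : nat) :
  [/\ (n %% 6 \in [:: 0; 2; 3])%N -> Num.sg (c n) = 1,
      (n %% 6 \in [:: 1; 5])%N -> Num.sg (c n) = -1
    & (n %% 6)%N = 4%N -> Num.sg (c n) = 0].
Proof.
have [w w3] := cube_root_unity n.
set y := reduce n 'X; have y0 : nilp n.+1 y by apply: nilp_reduceX.
(* M factors suffice both for the coefficient of index n to be final and for
   the product to agree with the infinite one modulo q^(n+1). *)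
have [M0 M0P] := c_def n; have /= gn := M0P _ (leq_maxl M0 n.+1).
set M := maxn M0 n.+1 in gn; have NM : (n.+1 <= M)%N by apply: leq_maxr.
set g := \prod_(_ <= _ < _) _ in gn.
have gE : g * (\prod_(1 <= m < M.+1) (1 - fpsX ^+ (2 * m))) ^+ 2 *
     (\prod_(1 <= m < M.+1) (1 - fpsX ^+ (3 * m))) ^+ 3 =
     \prod_(1 <= m < M.+1) (1 - fpsX ^+ (1 * m)).
  rewrite -!prodrXl -!big_split /=; apply: eq_big_nat => m /andP[m0 _].
  rewrite mul1n -mulrA divrK // unitrM !unitrX // fps_unit_subXn //; lia.
have {}gE : fps_reduce n g =
    euler n.+1 y * inveuler n.+1 (y ^+ 2) ^+ 2 * inveuler n.+1 (y ^+ 3) ^+ 3.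
  have := congr1 (fps_reduce n) gE; rewrite 2!fps_reduceM !fps_reduceX.
  rewrite !fps_reduce_eta // -/y expr1 => <-.
  have := eulerX_inv y0 (isT : 0 < 2)%N; have := eulerX_inv y0 (isT : 0 < 3)%N.
  by move=> H3 H2; ring: H2 H3.
move: gE; rewrite (eta_quotient_dissection w3 y0).
have z0 : nilp n.+1 (y ^+ 6) by apply: nilpX.
have [p0 p0_gt0 ->] := component0_positive z0 isT.
have [p1 p1_gt0 ->] := component1_positive z0 isT.
have [p2 p2_gt0 ->] := component2_positive z0 isT.
have [p3 p3_gt0 ->] := component3_positive z0 isT.
have [p5 p5_gt0 ->] := component5_positive z0 isT.
rewrite /y !peval_reduce -!rmorphXn -!rmorphM -!(rmorphB, rmorphD) => E.
have {E} := reduce_inj (ltnSn n) E; rewrite coef_fps_trunc // gn => ->.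
have qn : (n %/ 6 < n.+1)%N by rewrite ltnS leq_div.
have coefE r (p : {poly int}) : (r < 6)%N ->
    ('X^r * (p \Po 'X^6))`_n = if (n %% 6 == r)%N then p`_(n %/ 6) else 0.
  by move=> r6; rewrite [in LHS](divn_eq n 6) coef_Xn_comp_Xn ?ltn_mod.
have coefE0 := coefE 0%N p0 isT; rewrite expr0 mul1r in coefE0.
have coefE1 := coefE 1%N p1 isT; rewrite expr1 in coefE1.
rewrite !(coefB, coefD) coefE0 coefE1 !coefE //.
move: (p0_gt0 _ qn) (p1_gt0 _ qn) (p2_gt0 _ qn) (p3_gt0 _ qn) (p5_gt0 _ qn).
have : (n %% 6 < 6)%N by rewrite ltn_mod.
case: (n %% 6)%N => [|[|[|[|[|[|?]]]]]] //= _ q0 q1 q2 q3 q5.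
all: split=> // _; rewrite ?(subr0, add0r, addr0, sub0r, sgrN, sgr0) //.
all: by rewrite gtr0_sg.
Qed.
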